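(* $f(3,q)=\Theta(2^q q!)$; that is, there are absolute constants $c,C>0$ such that $c\,2^q q!\le f(3,q)\le C\,2^q q!$ for all positive integers $q$.
   Context: A word over an alphabet is a finite string of letters; a subword of $w$ is a string of consecutive letters of $w$. A word $w$ contains a pattern $P$ if there is a map assigning to each letter of $P$ a nonempty word (different letters may receive equal words) such that the word obtained from $P$ by replacing each letter by its assigned word is a subword of $w$. The Zimin words are defined by $Z_1=x_1$ and $Z_n=Z_{n-1}x_nZ_{n-1}$ with $x_n$ a new letter; $Z_3=x_1x_2x_1x_3x_1x_2x_1$. $f(n,q)$ denotes the smallest integer such that every word of length $f(n,q)$ over an alphabet of size $q$ contains $Z_n$. *)

(* Defs.v *)
From HB Require Import structures.
From mathcomp Require Import all_boot all_order all_algebra.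
From mathcomp Require Import boolp reals.

Set Implicit Arguments.
Unset Strict Implicit.
Unset Printing Implicit Defensive.

Definition subst_word (A B : Type) (h : A -> seq B) (P : seq A) : seq B :=
  flatten (map h P).

(* Distinct letters may have equal images. The values of h outside the letters
   of P are irrelevant. *)
Definition contains_pattern (A B : eqType) (w : seq B) (P : seq A) : Prop :=
  exists h : A -> seq B,
    (forall x, x \in P -> h x != [::]) /\ infix (subst_word h P) w.

(* The letter x_(n+1) is encoded by the number n; starting the recursion from
   the empty word gives Z_1 = x_1. *)
Fixpoint zimin (n : nat) : seq nat :=
  if n is n'.+1 then zimin n' ++ n' :: zimin n' else [::].

Definition zimin_unavoidable (n q m : nat) : Prop :=
  forall w : seq 'I_q, size w = m -> contains_pattern w (zimin n).

Lemma mem_zimin n x : x \in zimin n -> x < n.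
Proof.
elim: n => // n IHn /=; rewrite mem_cat inE => /or3P[/IHn/ltnW//|/eqP->//|].
by move/IHn/ltnW.
Qed.

(* Pigeonhole: among sufficiently many disjoint blocks of length m, no two of
   them adjacent, two are equal, and each of them contains Z_n. *)
Lemma zimin_unavoidable_ex n q : exists m, zimin_unavoidable n q m.
Proof.
elim: n => [|n [m Hm]].
  by exists 0 => w _; exists (fun _ => [::]); split => //; rewrite infix0s.
pose N := #|{: m.-tuple 'I_q}|.
exists (N.+1 * m.+1) => w Hw.
have szb (i : 'I_N.+1) : size (take m (drop (i * m.+1) w)) == m.
  rewrite size_takel // size_drop Hw -mulnBl.
  by rewrite (leq_trans (leqnSn m)) // leq_pmull // subn_gt0.
pose B (i : 'I_N.+1) : m.-tuple 'I_q := Tuple (szb i).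
have /injectivePn[i [j neq_ij eqB]] : ~~ injectiveb B.
  by apply/injectiveP => /leq_card; rewrite card_ord ltnn.
wlog lt_ij : i j neq_ij eqB / i < j.
  move=> IH; have := neq_ij; rewrite neq_ltn => /orP[lt_ij|lt_ji].
    exact: (IH i j).
  by apply: (IH j i) => //; rewrite eq_sym.
have [h [h0 /infixP[a [b Eu]]]] := Hm (B i) (eqP (szb i)).
set u := tval (B i) in Eu; set Z := subst_word h (zimin n) in Eu.
have Euj : take m (drop (j * m.+1) w) = u by rewrite /u eqB.
pose d := j * m.+1 - i * m.+1.
have lt_md : m < d.
  by rewrite /d -mulnBl leq_pmull // subn_gt0.
have Ed : j * m.+1 = (d - m) + (m + i * m.+1).
  by rewrite addnA subnK ?(ltnW lt_md) // /d subnK // leq_mul2r (ltnW lt_ij) orbT.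
pose v := drop (m + i * m.+1) w.
pose g := take (d - m) v.
have Ew : w = take (i * m.+1) w ++ u ++ g ++ u ++ drop m (drop (j * m.+1) w).
  rewrite -{1}(cat_take_drop (i * m.+1) w); congr (_ ++ _).
  rewrite -{1}(cat_take_drop m (drop (i * m.+1) w)); congr (_ ++ _).
  rewrite drop_drop -/v -{1}(cat_take_drop (d - m) v); congr (_ ++ _).
  by rewrite /v drop_drop -Ed -Euj cat_take_drop.
have le_jL : j * m.+1 <= N.+1 * m.+1 by rewrite leq_mul2r (ltnW (ltn_ord j)) orbT.
have le_g : d - m <= size v.
  rewrite /v size_drop Hw leq_subRL; first by rewrite addnC -Ed.
  by apply: leq_trans le_jL; rewrite Ed leq_addl.
have g_neq0 : g != [::].
  by rewrite -size_eq0 size_takel // subn_eq0 -ltnNge.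
pose h' x := if x == n then b ++ g ++ a else h x.
have EZ : map h' (zimin n) = map h (zimin n).
  by apply/eq_in_map => x /mem_zimin; rewrite /h'; case: eqP => // ->; rewrite ltnn.
exists h'; split.
  move=> x; rewrite /= mem_cat inE /h'; case: eqP => [_ _|_ /=].
    by rewrite -size_eq0 !size_cat !addn_eq0 !size_eq0 (negPf g_neq0) andbF.
  by rewrite orbb; apply: h0.
have -> : subst_word h' (zimin n.+1) = Z ++ (b ++ g ++ a) ++ Z.
  by rewrite /subst_word /= map_cat flatten_cat /= EZ /h' eqxx.
apply/infixP; exists (take (i * m.+1) w ++ a), (b ++ drop m (drop (j * m.+1) w)).
by rewrite {1}Ew Eu -!catA.
Qed.

Lemma zimin_unavoidable_exb n q : exists m, `[< zimin_unavoidable n q m >].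
Proof. by have [m Hm] := zimin_unavoidable_ex n q; exists m; apply/asboolP. Qed.

Definition zimin_length (n q : nat) : nat := ex_minn (zimin_unavoidable_exb n q).

Lemma zimin_lengthP n q :
  zimin_unavoidable n q (zimin_length n q) /\
  forall m, zimin_unavoidable n q m -> zimin_length n q <= m.
Proof.
rewrite /zimin_length; case: ex_minnP => m /asboolP Hm min_m.
by split=> // k /asboolP /min_m.
Qed.

(* Main.v *)
Require Import Defs.
From mathcomp Require Import all_boot all_order all_algebra.
From mathcomp Require Import boolp reals.
From mathcomp Require Import zify.

(** A word avoids [Z_2] iff each letter forms at most one run, of length at most
    two; it contains [Z_3] iff some factor [x v x] with [v] nonempty occurs
    twice with a gap.

    Upper bound: from a position [i], read until a letter is repeated
    non-adjacently, which closes a factor [x v x] starting at some [k >= i]. If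
    [x v] has [q - d] letters, then [k - i <= 2 d], since [W i ... W (k-1)]
    avoids [Z_2] and uses only the [d] other letters. In a word avoiding [Z_3]
    the factor has at most four occurrences, so the length is at most about
    [4 P(q)], where [P(q)] counts the words [x v] with weight [2 d + 1] and
    satisfies [P(q) = 2 q + 1 + 2 q P(q-1)]; hence [P(q) = O(2^q q!)].

    Lower bound: with [q = n + 2], take periods of [q] runs, one per letter. The
    letter [0] always comes first; the order of the others is constant during
    [2^n] periods and then changes by an adjacent transposition, going through
    all permutations in Steinhaus-Johnson-Trotter order. Which runs of period [t]
    are doubled is given by the lowest [n + 1] binary digits of [t] and their parity.
    A factor [x v x] that is minimal with [v] nonempty spans a complete turn, of
    [q - 1] or [q] runs, and determines its own position. *)

Set Implicit Arguments.
Unset Strict Implicit.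
Unset Printing Implicit Defensive.

(** * Containing [Z_3] in terms of positions *)

(* The image of [x_1] can be replaced by its first letter [x], the rest being moved
   into the images of [x_2] and [x_3]. *)
Definition zimin3_at (T : eqType) (W : nat -> T) (m : nat) :=
  exists i j d, [/\ 2 <= d, i + d.+1 < j, j + d < m, W i = W (i + d) &
    forall e, e <= d -> W (i + e) = W (j + e)].

Lemma subst_zimin3 (T : Type) (h : nat -> seq T) :
  subst_word h (zimin 3) = (h 0 ++ h 1 ++ h 0) ++ h 2 ++ (h 0 ++ h 1 ++ h 0).
Proof. by rewrite /subst_word /= cats0 -!catA. Qed.

Lemma contains_zimin3_at (T : eqType) (x0 : T) (w : seq T) :
  contains_pattern w (zimin 3) -> zimin3_at (nth x0 w) (size w).
Proof.
case=> h [h0 /infixP[a [b]]].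
have := h0 0 isT; have := h0 1 isT; have := h0 2 isT; rewrite subst_zimin3.
case: (h 0) => // x u; case: (h 1) => // y v; case: (h 2) => // z g _ _ _.
set U := (x :: u) ++ (y :: v) ++ x :: u.
(* [d] is the distance from the first letter [x] of the image of [x_1] to the start of its next
   copy. *)
move=> ->; pose d := size u + (size v).+2.
have Ud : size U = d + size u + 1 by rewrite /U !size_cat /= /d; lia.
have U0 : nth x0 U 0 = nth x0 U d.
  have Ed : d = size ((x :: u) ++ y :: v) by rewrite size_cat /= /d; lia.
  by rewrite /U catA [RHS]nth_cat Ed ltnn subnn.
rewrite -/U; clearbody U; exists (size a), (size a + size U + (size g).+1), d.
have Wi e : e < size U -> nth x0 (a ++ (U ++ (z :: g) ++ U) ++ b) (size a + e) = nth x0 U e.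
  move=> lt_e; rewrite nth_cat ifN; last by rewrite -leqNgt leq_addr.
  by rewrite addKn -!catA nth_cat lt_e.
split; first by rewrite /d; lia.
- by rewrite Ud; lia.
- by rewrite !size_cat /= Ud; lia.
- by rewrite -{1}[size a]addn0 !Wi ?Ud //; lia.
move=> e le_ed; rewrite Wi; last by rewrite Ud; lia.
rewrite nth_cat ifN; last by rewrite -leqNgt -!addnA leq_addr.
rewrite -!catA nth_cat ifN; last by rewrite -leqNgt; lia.
rewrite nth_cat ifN; last by rewrite -leqNgt /=; lia.
rewrite nth_cat /= (_ : _ - _ - _ - _ = e); last by lia.
by rewrite ifT // Ud; lia.
Qed.

Lemma zimin3_at_contains (T : eqType) (x0 : T) (w : seq T) :
  zimin3_at (nth x0 w) (size w) -> contains_pattern w (zimin 3).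
Proof.
case=> i [j [d [d2 lt_ij lt_jm Wd Wij]]].
pose sub p l := mkseq (fun e => nth x0 w (p + e)) l.
(* [x_1] becomes one letter, [x_2] the [d - 1] letters before its return, [x_3] the gap; [2 <= d]
   and [i + d.+1 < j] make them nonempty. *)
exists (fun n => nth [::] [:: sub i 1; sub i.+1 d.-1; sub (i + d).+1 (j - (i + d).+1)] n).
split.
  move=> x; rewrite /= !inE -!size_eq0.
  by do ![case/predU1P=> [->|]] => [||||||/eqP->] //=; rewrite size_mkseq; lia.
have subE p l l' : p + l + l' <= size w -> sub p (l + l') = sub p l ++ sub (p + l) l'.
  move=> _; rewrite /sub /mkseq iotaD map_cat add0n; congr (_ ++ _).
  by rewrite -[X in iota X]addn0 iotaDl -map_comp; apply/eq_map => e /=; rewrite addnA.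
have -> : subst_word (fun n => nth [::] [:: sub i 1; sub i.+1 d.-1;
    sub (i + d).+1 (j - (i + d).+1)] n) (zimin 3) = sub i (j + d.+1 - i).
  rewrite subst_zimin3.
  cbn [nth].
  have Ui : sub i 1 ++ sub i.+1 d.-1 ++ sub i 1 = sub i d.+1.
    have -> : d.+1 = 1 + (d.-1 + 1) by lia.
    rewrite !subE; try lia; rewrite addn1; do 2 congr (_ ++ _).
    rewrite /sub /mkseq /= !addn0 Wd; do 2 f_equal; lia.
  have Uj : sub i d.+1 = sub j d.+1.
    by apply/eq_in_map => e; rewrite mem_iota => /andP[_ lt_ed]; apply: Wij; lia.
  have -> : j + d.+1 - i = d.+1 + ((j - (i + d).+1) + d.+1) by lia.
  rewrite !subE; try lia.
  rewrite addnS (_ : (i + d).+1 + _ = j); last by lia.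
  by rewrite -Uj -Ui -!catA.
have -> : sub i (j + d.+1 - i) = take (j + d.+1 - i) (drop i w).
  apply: (@eq_from_nth _ x0); rewrite size_mkseq ?size_takel // ?size_drop; try lia.
  by move=> e lt_e; rewrite nth_mkseq // nth_take // nth_drop.
apply/infixP; exists (take i w), (drop (j + d.+1 - i) (drop i w)).
by rewrite !cat_take_drop.
Qed.

(** * Counting words that avoid [Z_2] *)

Section Zimin2Free.
Variable T : eqType.
Implicit Types (s g p : seq T) (x : T).

(** [behead] skips the next letter: an immediate repetition leaves no room for the image of
    [x_2]. *)
Fixpoint zimin2_free s : bool :=
  if s is x :: s' then (x \notin behead s') && zimin2_free s' else true.

Lemma zimin2_free_cat g p : zimin2_free g -> zimin2_free p ->
  (forall x, x \in g -> x \notin p) -> zimin2_free (g ++ p).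
Proof.
elim: g => //= x g IHg /andP[xg fg] fp dis.
rewrite {}IHg // ?andbT; last by move=> y yg; rewrite dis // inE yg orbT.
have := dis x; rewrite inE eqxx => /(_ isT) xp.
case: g xg {fg dis} => [_|y g] /=; first by apply: contra xp; apply: mem_behead.
by rewrite mem_cat negb_or xp andbT.
Qed.

Lemma zimin2_free_mkseq (f : nat -> T) n :
  (forall a b, a.+2 <= b < n -> f a <> f b) -> zimin2_free (mkseq f n).
Proof.
elim: n f => // n IHn f Hf; rewrite /mkseq /= (iotaDl 1 0) -map_comp.
apply/andP; split; last first.
  by apply: (IHn (f \o succn)) => a b Hab; apply: Hf; lia.
case: n {IHn} Hf => // n Hf; rewrite /= (iotaDl 1 0) -map_comp.
apply/mapP => -[b]; rewrite mem_iota => /andP[_ lt_b] /=.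
by apply: Hf; lia.
Qed.

(* [offset_words n s] lists the pairs of a word [g] without [Z_2] over [s],
   where [size s = n], and an offset [<= 2 d], with [d] the number of letters
   of [s] that are not in [g]. *)
Fixpoint offset_words (n : nat) s : seq (seq T * nat) :=
  if n is n'.+1 then
    [seq ([::], o) | o <- iota 0 (2 * n).+1] ++
    flatten [seq [seq (x :: go.1, go.2) | go <- offset_words n' (rem x s)] ++
                 [seq (x :: x :: go.1, go.2) | go <- offset_words n' (rem x s)] | x <- s]
  else [:: ([::], 0)].

(** The summand 3 makes the induction close: each of the [n.+1] letters gains 6 from its two lists,
    which pays for the [2 * n + 3] offsets of the empty word and the new 3. *)
Lemma size_offset_words n s : size s = n ->
  size (offset_words n s) + 3 <= 4 * (2 ^ n * n`!).
Proof.
elim: n s => // n IHn s sz_s; rewrite /= size_cat size_map size_iota.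
have le_flat (r : seq T) : {subset r <= s} ->
    size (flatten [seq [seq (x :: go.1, go.2) | go <- offset_words n (rem x s)] ++
      [seq (x :: x :: go.1, go.2) | go <- offset_words n (rem x s)] | x <- r])
    + size r * 6 <= size r * (8 * (2 ^ n * n`!)).
  elim: r => // x r IHr sub_r; rewrite /= !size_cat !size_map !mulSn.
  have sx : x \in s by apply: sub_r; rewrite mem_head.
  have : size (rem x s) = n by rewrite size_rem // sz_s.
  move/IHn; have: {subset r <= s} by move=> y yr; apply: sub_r; rewrite inE yr orbT.
  by move/IHr; lia.
have := le_flat s (fun _ => id); rewrite sz_s factS expnS; set F := size (flatten _).
by rewrite -[2 * _ * _]mulnA [2 ^ n * (_ * _)]mulnCA; move: (2 ^ n * n`!) => a; lia.
Qed.

Lemma subset_rem x (r s : seq T) : x \notin r -> {subset r <= s} -> {subset r <= rem x s}.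
Proof.
move=> xr sub y yr; apply: rem_mem; last exact: sub.
by apply: contraNneq xr => <-.
Qed.

(** After the first two positions the first letter never returns, so each letter of [s] accounts for
    at most two positions. *)
Lemma zimin2_free_size n s p : size s = n -> {subset p <= s} ->
  zimin2_free p -> size p <= 2 * n.
Proof.
elim: n s p => [|n IHn] s [|x p] // sz_s sub_p.
  by case: s sz_s sub_p => // _ /(_ x (mem_head _ _)).
have sx : x \in s by apply: sub_p; rewrite mem_head.
have sz_r : size (rem x s) = n by rewrite size_rem // sz_s.
move=> /= /andP[xp fp].
have fbp : zimin2_free (behead p) by case: (p) fp => //= y p' /andP[].
have : size (behead p) <= 2 * n.
  apply: IHn sz_r _ fbp; apply: subset_rem => // y /mem_behead yp.
  by apply: sub_p; rewrite inE yp orbT.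
by rewrite size_behead; lia.
Qed.

Lemma mem_offset_words n s g p : size s = n -> {in g, forall x, x \notin p} -> {subset g ++ p <= s} ->
  zimin2_free (g ++ p) -> (g, size p) \in offset_words n s.
Proof.
elim: n s g => [|n IHn] s g sz_s dis sub_gp f_gp.
  have : g ++ p = [::].
    case: s sz_s sub_gp => // _; case: (g ++ p) => // x r /(_ x (mem_head _ _)).
    by rewrite in_nil.
  by case: g {dis sub_gp f_gp} => //= ->; rewrite inE.
rewrite mem_cat; case: g dis sub_gp f_gp => [|x g] dis sub_gp f_gp.
  rewrite map_f // mem_iota /= add0n ltnS.
  exact: zimin2_free_size sz_s sub_gp f_gp.
have sx : x \in s by apply: sub_gp; rewrite mem_head.
have sz_r : size (rem x s) = n by rewrite size_rem // sz_s.
move: f_gp => /= /andP[xgp fgp].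
have sub_s r : {subset r <= g ++ p} -> {subset r <= s}.
  by move=> sub y /sub yr; apply: sub_gp; rewrite inE yr orbT.
have dis_g : {in g, forall y, y \notin p} by move=> y yg; apply: dis; rewrite inE yg orbT.
apply/orP; right; apply/flatten_mapP; exists x => //; rewrite mem_cat.
(* The run of [x] at the head has length one or two, matching the two lists in [offset_words]. *)
have [xg|xg] := boolP (x \in g); last first.
  apply/orP; left; apply/mapP; exists (g, size p) => //; apply: IHn => //.
  by apply: subset_rem; [rewrite mem_cat negb_or xg dis ?mem_head | apply: sub_s].
case: g xg xgp fgp sub_s dis_g {dis sub_gp} => // y g.
rewrite inE => /predU1P[<- /= xgp /andP[_ fgp] sub_s dis_g|xg]; last by rewrite /= mem_cat xg.
apply/orP; right; apply/mapP; exists (g, size p) => //; apply: IHn => //.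
  by move=> z zg; apply: dis_g; rewrite inE zg orbT.
by apply: subset_rem => //; apply: sub_s => z zr; rewrite inE zr orbT.
Qed.

End Zimin2Free.

(** * The upper bound *)

(** [j] is the least position whose letter already occurred since [i] at distance at least two, and
    [k] is the least such earlier position. *)
Lemma first_return q (W : nat -> 'I_q) i :
  exists k j, [/\ i <= k /\ k.+2 <= j, j <= i + 2 * q, W k = W j,
    (forall a b, i <= a -> a.+2 <= b < j -> W a <> W b) &
    forall a, i <= a < k -> W a <> W j].
Proof.
have exj : exists j, (j <= i + 2 * q) && [exists a : 'I_j, [&& i <= a, a.+2 <= j & W a == W j]].
  (* Spacing the [q.+1] candidates by 2 makes any two of them nonadjacent. *)
  have /injectivePn[a [b neq_ab eqW]] : ~~ injectiveb (fun a : 'I_q.+1 => W (i + 2 * a)).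
    by apply/injectiveP => /leq_card; rewrite !card_ord ltnn.
  wlog lt_ab : a b neq_ab eqW / a < b.
    move=> IH; have := neq_ab; rewrite neq_ltn => /orP[|lt]; first exact: IH.
    by apply: (IH b a) => //; rewrite eq_sym.
  exists (i + 2 * b); have := ltn_ord b; rewrite ltnS => le_b.
  rewrite leq_add2l leq_mul2l le_b; apply/existsP.
  have lt_abi : i + 2 * a < i + 2 * b by lia.
  by exists (Ordinal lt_abi); rewrite /= eqW eqxx leq_addr andbT; lia.
case: (ex_minnP exj) => j /andP[le_j /existsP[a /and3P[le_ia le_aj Waj]]] min_j.
have exk : exists k, [&& i <= k, k.+2 <= j & W k == W j] by exists a; rewrite le_ia le_aj.
case: (ex_minnP exk) => k /and3P[le_ik le_kj /eqP Wkj] min_k.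
exists k, j; split => // [b c le_ib /andP[le_bc lt_cj] Wbc|b /andP[le_ib lt_bk] Wbj].
  have lt_bc : b < c by lia.
  suff: j <= c by rewrite leqNgt lt_cj.
  apply: min_j.
  apply/andP; split; first lia.
  by apply/existsP; exists (Ordinal lt_bc); rewrite /= le_ib le_bc Wbc eqxx.
suff: k <= b by rewrite leqNgt lt_bk.
by apply: min_k; rewrite le_ib Wbj eqxx andbT; lia.
Qed.

(* The position [i] is recovered from the factor [W k ... W j] of [first_return],
   from [k - i], and from the distance between [k] and the first occurrence of
   that factor, which takes at most four values if [Z_3] is avoided. *)
Lemma zimin3_upper q : zimin_unavoidable 3 q (16 * (2 ^ q * q`!) + 2 * q).
Proof.
case: q => [|q] w; first by case: w => // -[].
set n := _ + 2 * _; move=> sz_w; pose W := nth ord0 w.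
have [|avoid] := pselect (zimin3_at W n).
  by rewrite -sz_w => /zimin3_at_contains.
exfalso; pose s := enum 'I_q.+1.
have sz_s : size s = q.+1 by rewrite size_enum_ord.
have sub_s (r : seq 'I_q.+1) : {subset r <= s} by move=> x _; rewrite mem_enum.
pose factor p l := mkseq (fun e => W (p + e)) l.
pose first_occ u := find (fun p => factor p (size u) == u) (iota 0 n).
(* [F] decodes a start [i]: locate the first occurrence of the word closed by its own first letter,
   add one of four distances to reach [k], and subtract the offset [k - i]. *)
pose F (go : seq 'I_q.+1 * nat) t :=
  first_occ (rcons go.1 (head ord0 go.1)) + nth 0 [:: 0; 1; size go.1; (size go.1).+1] t - go.2.
(* Every [i < n - 2 * q.+1] is a value of [F], and [n] is chosen so that there are too few
   values. *)
have: size (iota 0 (n - 2 * q.+1)) <= size [seq F go t | go <- offset_words q.+1 s, t <- iota 0 4].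
  apply: uniq_leq_size (iota_uniq _ _) _ => i; rewrite mem_iota add0n leq0n andTb => lt_i.
  have [k [j [[le_ik le_kj] le_j Wkj free_ij min_k]]] := first_return W i.
  pose g := factor k (j - k); pose p := factor i (k - i).
  have sz_g : size g = j - k by rewrite size_mkseq.
  have gW x : x \in g -> exists2 a, k <= a < j & x = W a.
    case/mapP=> e; rewrite mem_iota => /andP[_ lt_e] ->; exists (k + e) => //; lia.
  have pW x : x \in p -> exists2 a, i <= a < k & x = W a.
    case/mapP=> e; rewrite mem_iota => /andP[_ lt_e] ->; exists (i + e) => //; lia.
  have dis : {in g, forall x, x \notin p}.
    move=> _ /gW[a lt_a ->]; apply/negP => /pW[b lt_b Wab].
    have [Eak|neq_ak] := eqVneq a k.
      by apply: (min_k b) => //; rewrite -Wab Eak.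
    by apply: (free_ij b a); [lia | lia | rewrite Wab].
  have gop : (g, k - i) \in offset_words q.+1 s.
    rewrite -[k - i](size_mkseq (fun e => W (i + e))); apply: mem_offset_words => //.
    apply: zimin2_free_cat => //; apply: zimin2_free_mkseq => a b Hab; apply: free_ij; lia.
  have g0 : head ord0 g = W k by rewrite /g -nth0 nth_mkseq ?addn0 //; lia.
  have Eu : rcons g (head ord0 g) = factor k (j - k).+1.
    by rewrite g0 /factor /mkseq -[(j - k).+1]addn1 iotaD map_cat -cats1 /= add0n subnKC ?Wkj //; lia.
  have lt_kn : k < n by lia.
  set u := rcons g (head ord0 g) in Eu; pose k0 := first_occ u.
  have sz_u : size u = (j - k).+1 by rewrite size_rcons sz_g.
  have occ_k : factor k (size u) == u by rewrite sz_u Eu.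
  have le_k0 : k0 <= k.
    rewrite leqNgt; apply/negP => /(before_find 0).
    by rewrite nth_iota // add0n occ_k.
  have /eqP Ek0 : factor k0 (size u) == u.
    have : has (fun p => factor p (size u) == u) (iota 0 n).
      by apply/hasP; exists k => //; rewrite mem_iota.
    by move/(nth_find 0); rewrite -/(first_occ u) -/k0 nth_iota //; exact: leq_ltn_trans lt_kn.
  have occ_k0 e : e <= j - k -> W (k0 + e) = W (k + e).
    move=> le_e; have := congr1 (fun u => nth ord0 u e) Ek0.
    by rewrite sz_u Eu !nth_mkseq.
  (* With [d = j - k]: a distance above [d + 1] leaves a gap and gives [Z_3]; one strictly between 1
     and [d] makes [W k] recur before [j], against the choice of [j]. *)
  have tP : k - k0 \in [:: 0; 1; size g; (size g).+1].
    rewrite !inE sz_g; set dk := k - k0.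
    have [lt_dk|le_dk] := ltnP (j - k).+1 dk.
      case: avoid; exists k0, k, (j - k); split=> //; rewrite /dk in lt_dk; try lia.
      by have := occ_k0 0 isT; rewrite !addn0 occ_k0 // subnKC -?Wkj //; lia.
    have : W k = W (k + dk) -> [|| dk == 0, dk == 1, dk == j - k | dk == (j - k).+1].
      move=> Wd; have : ~ (2 <= dk < j - k) by move=> ?; apply: (free_ij k (k + dk)) Wd; lia.
      lia.
    have [|lt] := leqP dk (j - k); last by lia.
    by move=> le; apply; rewrite -occ_k0 // /dk subnKC.
  apply/allpairsPdep; pose t := index (k - k0) [:: 0; 1; size g; (size g).+1].
  exists (g, k - i), t; split => //.
    by rewrite mem_iota /= add0n -[4]/(size [:: 0; 1; size g; (size g).+1]) index_mem.
  by rewrite /F [(_, _).1]/= [(_, _).2]/= -/u -/k0 -[nth _ _ _]/(nth 0 [:: 0; 1; size g; (size g).+1] t) nth_index //; lia.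
have := size_offset_words sz_s; rewrite size_allpairs !size_iota /n.
rewrite addnK; move: (2 ^ q.+1 * q.+1`!) (size (offset_words _ _)) => a b; clear; lia.
Qed.

(** * Words built from single and doubled blocks *)

Section Blocks.
Variables (T : eqType) (L : nat -> T) (D : nat -> bool).

(* The word whose [k]-th block is the letter [L k], repeated iff [D k]; the
   state at a position is the index of its block and whether the position is
   the second one of that block. *)
Fixpoint block_state (p : nat) : nat * bool :=
  if p is p'.+1 then
    let: (k, b) := block_state p' in
    if D k && ~~ b then (k, true) else (k.+1, false)
  else (0, false).

Definition block_at p := (block_state p).1.
Definition block_word p := L (block_at p).

Lemma block_at_step p : block_at p <= block_at p.+1 <= (block_at p).+1.
Proof. by rewrite /block_at /=; case: (block_state p) => k b; case: ifP => /=; lia. Qed.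

Lemma block_at_mono p e : block_at p <= block_at (p + e).
Proof.
elim: e => [|e IHe]; first by rewrite addn0.
by rewrite addnS; have := block_at_step (p + e); lia.
Qed.

Lemma block_at_le p : block_at p <= p.
Proof. by elim: p => // p IHp; have := block_at_step p; lia. Qed.

Lemma block_at_lt2 p : block_at p < block_at p.+2.
Proof.
rewrite /block_at /=; case: (block_state p) => k [] /=; rewrite ?andbF ?andbT /=.
  by case: ifP => /=; lia.
by case: (D k) => /=; rewrite ?andbF //=; case: ifP => /=; lia.
Qed.

Lemma block_at_dist p q : block_at p + 2 <= block_at q -> p.+2 <= q.
Proof.
move=> le_pq; have [//|le_qp] := leqP p.+2 q; have [le_q|lt_p] := leqP q p.
  by have := block_at_mono q (p - q); rewrite subnKC //; lia.
by have := block_at_step p; rewrite (_ : p.+1 = q); lia.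
Qed.

(** Where a block starts, its flag shows one position later; so equal factors of the word yield
    equal flags. *)
Lemma doubled_block_at p : block_at p < block_at p.+1 ->
  D (block_at p.+1) = (block_at p.+2 == block_at p.+1).
Proof.
rewrite /block_at /=; case: (block_state p) => k b.
case: (D k && ~~ b) => /=; first by rewrite ltnn.
by move=> _; rewrite andbT; case: (D k.+1) => /=; lia.
Qed.

Lemma block_first p d k : block_at p < k <= block_at (p + d) ->
  exists e, [/\ e < d, block_at (p + e) < k & block_at (p + e).+1 = k].
Proof.
move=> /andP[lt_pk le_k].
have ex_e : exists e, k <= block_at (p + e) by exists d.
case: (ex_minnP ex_e) => -[|e] le_ke min_e; first by rewrite addn0 in le_ke; lia.
have := min_e d le_k; have : block_at (p + e) < k.
  by rewrite ltnNge; apply/negP => /min_e; rewrite ltnn.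
move: le_ke; rewrite addnS => le_ke lt_e le_ed; exists e; split => //.
by have := block_at_step (p + e); lia.
Qed.

Variable K : nat.
Hypothesis L_neq : forall k, k.+1 < K -> L k <> L k.+1.
(** Only flags of inner blocks are compared, since the ends of a factor may cut the two end
    blocks. *)
Hypothesis L_uniq : forall k k' l, 2 <= l -> k + l < K -> k' + l < K ->
  L k = L (k + l) -> (forall m, m <= l -> L (k + m) = L (k' + m)) ->
  (forall m, 0 < m < l -> D (k + m) = D (k' + m)) ->
  (forall m m', m < m' < l -> L (k + m) <> L (k + m')) -> k = k'.

Lemma block_at_eq_letter p : p.+1 < K ->
  (block_at p.+1 == block_at p) = (block_word p.+1 == block_word p).
Proof.
move=> lt_pK; apply/eqP/eqP; rewrite /block_word; first by move=> ->.
move=> Lp.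
have [//|neq_b] := eqVneq (block_at p.+1) (block_at p).
have Eb : block_at p.+1 = (block_at p).+1 by have := block_at_step p; lia.
case: (@L_neq (block_at p)); rewrite -Eb //.
exact: leq_ltn_trans (block_at_le _) lt_pK.
Qed.

(** Both copies of a shortest repetition [x v x] start in the same block by [L_uniq]; the second
    then starts one position later, and comparing the next positions puts three of them in one
    block. *)
Lemma block_word_zimin3_free : ~ zimin3_at block_word K.
Proof.
case=> i0 [j0 [d0 [d02 lt_ij0 lt_j0 Wd0 Wij0]]].
(* A shortest repetition at distance at least two inside the first copy; the same shift [a] places
   it in the second copy. *)
have exd : exists d, [exists a : 'I_d0, [&& 2 <= d, a + d <= d0 &
    block_word (i0 + a) == block_word (i0 + a + d)]].
  have d0_gt0 : 0 < d0 by lia.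
  by exists d0; apply/existsP; exists (Ordinal d0_gt0); rewrite /= addn0 d02 -Wd0 eqxx leqnn.
case: (ex_minnP exd) => d /existsP[a /and3P[d2 le_ad /eqP Wd]] min_d.
set i := i0 + a in Wd; pose j := j0 + a.
have lt_ij : i < j by rewrite /i /j; lia.
have lt_jK : j + d < K by rewrite /j; lia.
have Wij e : e <= d -> block_word (i + e) = block_word (j + e).
  by move=> le_e; rewrite /i /j -!addnA Wij0 //; lia.
have Wneq e e' : e.+2 <= e' -> e' <= d -> e' - e < d -> block_word (i + e) <> block_word (i + e').
  move=> le_e le_e' lt_d We; have : d <= e' - e; last by lia.
  apply: min_d; apply/existsP; have lt_ae : a + e < d0 by lia.
  exists (Ordinal lt_ae) => /=; apply/and3P; split; try lia.
  have -> : i0 + (a + e) = i + e by rewrite /i addnA.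
  by rewrite -addnA subnKC ?We //; lia.
clear exd min_d Wij0; clearbody i j; clear i0 j0 d0 d02 lt_ij0 lt_j0 Wd0 le_ad a.
(* Neighbouring blocks carry different letters, so block boundaries are visible in the word and
   agree in both copies. *)
have Eb e : e <= d -> block_at (i + e) + block_at j = block_at (j + e) + block_at i.
  elim: e => [|e IHe] lt_ed; first by rewrite !addn0 addnC.
  have := IHe (ltnW lt_ed); rewrite !addnS.
  have := block_at_step (i + e); have := block_at_step (j + e).
  have : (block_at (i + e).+1 == block_at (i + e)) = (block_at (j + e).+1 == block_at (j + e)).
    rewrite !block_at_eq_letter; try lia.
    by rewrite -!addnS !Wij // ltnW.
  by do 2 case: eqP => //; lia.
pose k := block_at i; pose k' := block_at j; pose l := block_at (i + d) - k.
have Ekl : block_at (i + d) = k + l by rewrite /l subnKC // block_at_mono.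
have Ekl' : block_at (j + d) = k' + l by have := Eb d (leqnn d); rewrite /k' Ekl /k; lia.
have Lkl : L k = L (k + l) by rewrite -Ekl.
have l2 : 2 <= l.
  have : block_at i.+2 <= k + l.
    by have := block_at_mono i.+2 (d - 2); rewrite -Ekl (_ : i.+2 + (d - 2) = i + d) //; lia.
  have := block_at_lt2 i; rewrite -/k; case: l Ekl Ekl' Lkl => [|[|l]] // Ekl _ Lkl; first by lia.
  case: (@L_neq k); last by rewrite Lkl addn1.
  by have := block_at_le (i + d); lia.
have first m : 0 < m <= l -> exists e, [/\ e < d, block_at (i + e) < k + m,
    block_at (j + e) < k' + m, block_at (i + e).+1 = k + m & block_at (j + e).+1 = k' + m].
  move=> m_int; have [|e [lt_ed lt_e Ee]] := @block_first i d (k + m).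
    by rewrite Ekl /k; lia.
  exists e; split => //.
    by have := Eb e (ltnW lt_ed); rewrite -/k -/k'; lia.
  by have := Eb e.+1 lt_ed; rewrite !addnS Ee -/k -/k'; lia.
have Ekk' : k = k'.
  apply: (L_uniq l2) => //.
  - by rewrite -Ekl; have := block_at_le (i + d); lia.
  - by rewrite -Ekl'; have := block_at_le (j + d); lia.
  - case=> [_|m le_ml]; first by have := Wij 0 isT; rewrite !addn0.
    have [//|e [lt_ed _ _ <- <-]] := first m.+1.
    by rewrite -!addnS; apply: Wij.
  - move=> m /andP[m_gt0 lt_ml]; have [|e [lt_ed lt_ik lt_jk Ei Ej]] := first m.
      by rewrite m_gt0 ltnW.
    have lt_ed2 : e.+2 <= d.
      rewrite ltn_neqAle lt_ed andbT; apply/eqP => Ee; move: Ekl; rewrite -Ee addnS Ei; lia.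
    rewrite -Ei -Ej !doubled_block_at ?Ei ?Ej //.
    by have := Eb _ lt_ed2; rewrite !addnS -/k -/k' => ?; apply/eqP/eqP; lia.
  move=> m m' /andP[lt_mm lt_ml] Lmm.
  have [neq_mm|neq_mm] := eqVneq m' m.+1.
    apply: (@L_neq (k + m)); last by rewrite Lmm neq_mm addnS.
    by have := block_at_le (i + d); lia.
  have [|e' [lt_ed' _ _ Ee' _]] := first m'; first by lia.
  have lt_ed2 : e'.+2 <= d.
    rewrite ltn_neqAle lt_ed' andbT; apply/eqP => Ed; move: Ekl; rewrite -Ed addnS Ee'; lia.
  (* Block [k] may have been entered before [i], so for [m = 0] the position [i] itself is taken. *)
  have [e [lt_ed Ee]] : exists e, e < d /\ block_at (i + e) = k + m.
    case: m lt_mm Lmm neq_mm => [|m] lt_mm Lmm neq_mm.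
      by exists 0; rewrite !addn0; split; lia.
    have [|e [lt_ed Ei Ej Ee _]] := first m.+1; first by lia.
    exists e.+1; rewrite addnS; split => //.
    rewrite ltn_neqAle lt_ed andbT; apply/eqP => Ed; move: Ekl; rewrite -Ed addnS Ee; lia.
  have := @block_at_dist (i + e) (i + e'.+1); rewrite Ee (addnS i) Ee' => dist.
  have le_e : e.+2 <= e'.+1 by have := dist; lia.
  apply: (Wneq _ _ le_e); [exact: lt_ed' | lia |].
  by rewrite (addnS i) /block_word Ee Ee'.
have Eji : j = i.+1.
  have := block_at_lt2 i; have := block_at_mono i.+2 (j - i.+2).
  have [/subnKC->|] := leqP i.+2 j; last by lia.
  by rewrite -/k -/k' in Ekk' *; lia.
have := Eb 1 (ltnW d2); have := block_at_lt2 i; rewrite Eji !addn1 -[block_at i]/k Ekk' /k' Eji.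
by lia.
Qed.

End Blocks.

(** * Listing permutations by adjacent transpositions *)

Section AdjacentSwaps.
Variable T : eqType.
Implicit Types (s t : seq T) (x : T) (ss : seq (seq T)).

Definition adjacent_swap s t :=
  `[< exists u v a b, s = u ++ a :: b :: v /\ t = u ++ b :: a :: v >].

Lemma adjacent_swap_sym : symmetric adjacent_swap.
Proof.
by move=> s t; apply/asboolP/asboolP => -[u [v [a [b [-> ->]]]]]; exists u, v, b, a.
Qed.

Lemma adjacent_swap_cons x s t : adjacent_swap s t -> adjacent_swap (x :: s) (x :: t).
Proof.
by move=> /asboolP[u [v [a [b [-> ->]]]]]; apply/asboolP; exists (x :: u), v, a, b.
Qed.

Lemma adjacent_swap_rcons x s t : adjacent_swap s t -> adjacent_swap (rcons s x) (rcons t x).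
Proof.
move=> /asboolP[u [v [a [b [-> ->]]]]]; apply/asboolP; exists u, (rcons v x), a, b.
by rewrite !rcons_cat.
Qed.

Fixpoint insertions x s : seq (seq T) :=
  if s is a :: s' then (x :: s) :: map (cons a) (insertions x s') else [:: [:: x]].

Lemma size_insertions x s : size (insertions x s) = (size s).+1.
Proof. by elim: s => //= a s IHs; rewrite size_map IHs. Qed.

Lemma insertions_cons x s : insertions x s = (x :: s) :: behead (insertions x s).
Proof. by case: s. Qed.

Lemma last_insertions x s : last [::] (insertions x s) = rcons s x.
Proof.
elim: s => //= a s; rewrite insertions_cons /= => IHs.
by rewrite (last_map (cons a)) IHs.
Qed.

Lemma sorted_insertions x s : sorted adjacent_swap (insertions x s).
Proof.
elim: s => //= a s; rewrite insertions_cons /= => IHs; apply/andP; split.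
  by apply/asboolP; exists [::], s, x, a.
by rewrite path_map; apply: sub_path IHs => t u; apply: adjacent_swap_cons.
Qed.

Lemma perm_insertions x s t : t \in insertions x s -> perm_eq t (x :: s).
Proof.
elim: s t => [|a s IHs] t /=; first by rewrite inE => /eqP->.
rewrite inE => /predU1P[->//|/mapP[u /IHs pu ->]].
rewrite perm_sym -[x :: a :: s]/([:: x] ++ [:: a] ++ s) perm_catCA /= perm_cons.
by rewrite perm_sym.
Qed.

(** Deleting [x] undoes an insertion, which keeps the insertions into different words apart. *)
Lemma rem_insertions x s t : x \notin s -> t \in insertions x s -> rem x t = s.
Proof.
elim: s t => [|a s IHs] t /=; first by rewrite inE => _ /eqP-> /=; rewrite eqxx.
rewrite !inE negb_or => /andP[neq_xa xs] /predU1P[->/=|/mapP[u tu ->] /=].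
  by rewrite eqxx.
by rewrite eq_sym (negPf neq_xa) (IHs u).
Qed.

Lemma uniq_insertions x s : x \notin s -> uniq (insertions x s).
Proof.
elim: s => //= a s IHs; rewrite inE negb_or => /andP[neq_xa xs].
rewrite map_inj_uniq; last by move=> u v [].
rewrite IHs // andbT; apply/mapP => -[u _ [Exa _]].
by rewrite Exa eqxx in neq_xa.
Qed.

(** The direction alternates so that [x] stays at the same end while the underlying word changes. *)
Fixpoint weave x (b : bool) ss : seq (seq T) :=
  if ss is s :: ss' then
    (if b then insertions x s else rev (insertions x s)) ++ weave x (~~ b) ss'
  else [::].

Lemma size_weave x b n ss : all (fun s => size s == n) ss ->
  size (weave x b ss) = size ss * n.+1.
Proof.
elim: ss b => //= s ss IHss b /andP[/eqP sz_s /IHss IH].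
by rewrite size_cat IH mulSn; case: b; rewrite ?size_rev size_insertions sz_s.
Qed.

Lemma mem_weave x b ss t : t \in weave x b ss -> exists2 s, s \in ss & t \in insertions x s.
Proof.
elim: ss b => //= s ss IHss b; rewrite mem_cat => /orP[ts|/IHss[u us tu]].
  by exists s; rewrite ?mem_head //; case: b ts; rewrite ?mem_rev.
by exists u; rewrite // inE us orbT.
Qed.

Lemma uniq_weave x b ss : all (fun s => x \notin s) ss -> uniq ss -> uniq (weave x b ss).
Proof.
elim: ss b => //= s ss IHss b /andP[xs xss] /andP[s_ss uss].
rewrite cat_uniq IHss // andbT; apply/andP; split.
  by case: b; rewrite ?rev_uniq uniq_insertions.
apply/hasPn => t /mem_weave[u u_ss tu]; apply/negP => ts.
have {}ts : t \in insertions x s by case: b ts; rewrite ?mem_rev.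
by case/negP: s_ss; rewrite -(rem_insertions xs ts) (rem_insertions _ tu) // (allP xss).
Qed.

(** Each run ends with [x] where the next, opposite run starts, so the step between runs is the swap
    from one word of [ss] to the next. *)
Lemma sorted_weave x b ss : sorted adjacent_swap ss -> sorted adjacent_swap (weave x b ss).
Proof.
pose first (b : bool) s := if b then x :: s else rcons s x.
pose run b s := if b then insertions x s else rev (insertions x s).
have run_cons c s : run c s = first c s :: behead (run c s).
  case: c; first exact: insertions_cons.
  have := last_insertions x s; rewrite /run /first /=.
  by case/lastP: (insertions x s) (insertions_cons x s) => // r y _; rewrite last_rcons rev_rcons => ->.
have run_last c s : last [::] (run c s) = first (~~ c) s.
  case: c; first exact: last_insertions.
  by rewrite /run insertions_cons rev_cons last_rcons.
have run_sorted c s : sorted adjacent_swap (run c s).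
  case: c; first exact: sorted_insertions.
  rewrite /run rev_sorted (@eq_sorted _ _ adjacent_swap) ?sorted_insertions //.
  by move=> t u; rewrite adjacent_swap_sym.
case: ss => // s ss /=; rewrite -/(run b s).
elim: ss s b => [|t ss IHss] s b; first by rewrite cats0.
move=> /andP[st pss]; rewrite run_cons /= cat_path.
have := run_sorted b s; have := run_last b s; rewrite run_cons /= => -> ->.
have := IHss t (~~ b) pss; rewrite /= -/(run (~~ b) t) run_cons /= => ->; rewrite andbT.
by case: (b) => /=; [apply: adjacent_swap_rcons | apply: adjacent_swap_cons].
Qed.
End AdjacentSwaps.

(* The Steinhaus-Johnson-Trotter list of the permutations of [1, ..., n]. *)
Fixpoint sjt (n : nat) : seq (seq nat) :=
  if n is n'.+1 then weave n true (sjt n') else [:: [::]].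

Lemma sjt_perm n s : s \in sjt n -> perm_eq s (iota 1 n).
Proof.
elim: n s => [|n IHn] s; first by rewrite inE => /eqP->.
case/mem_weave => t /IHn pt /perm_insertions ps.
have -> : iota 1 n.+1 = rcons (iota 1 n) n.+1 by rewrite -cats1 -[n.+1]addn1 iotaD add1n addn1.
by rewrite (perm_trans ps) // perm_sym perm_rcons perm_cons perm_sym.
Qed.

Lemma sjt_size n : size (sjt n) = n`!.
Proof.
elim: n => //= n IHn; rewrite (@size_weave _ _ _ n) ?IHn ?factS 1?mulnC //.
by apply/allP => s /sjt_perm/perm_size; rewrite size_iota => ->.
Qed.

Lemma sjt_uniq n : uniq (sjt n).
Proof.
elim: n => //= n IHn; apply: uniq_weave => //.
by apply/allP => s /sjt_perm/perm_mem ->; rewrite mem_iota add1n ltnn andbF.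
Qed.

Lemma sjt_sorted n : sorted (@adjacent_swap nat) (sjt n).
Proof. by elim: n => //= n; apply: sorted_weave. Qed.

(** * Binary digits with a parity check *)

Lemma modn_exp2S t r : t %% 2 ^ r.+1 = odd (t %/ 2 ^ r) * 2 ^ r + t %% 2 ^ r.
Proof.
have r_gt0 : 0 < 2 ^ r by rewrite expn_gt0.
rewrite {1}(divn_eq t (2 ^ r)) -{1}(odd_double_half (t %/ 2 ^ r)) mulnDl -muln2 -mulnA.
rewrite -expnS addnAC addnC modnMDl modn_small // expnS.
by have := ltn_pmod t r_gt0; case: odd; lia.
Qed.

Lemma eqmod_exp2 t t' r :
  (forall i, i < r -> odd (t %/ 2 ^ i) = odd (t' %/ 2 ^ i)) <-> t = t' %[mod 2 ^ r].
Proof.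
split=> [|Etr i lt_ir].
  elim: r => [|r IHr] Hr; first by rewrite expn0 !modn1.
  by rewrite !modn_exp2S Hr // IHr // => i /ltnW/Hr.
have : t = t' %[mod 2 ^ i.+1].
  have /modn_dvdm D : 2 ^ i.+1 %| 2 ^ r by rewrite dvdn_exp2l.
  by rewrite -D Etr D.
have i_gt0 : 0 < 2 ^ i by rewrite expn_gt0.
rewrite !modn_exp2S => /(congr1 (divn^~ (2 ^ i))).
by rewrite !divnMDl // !(divn_small (ltn_pmod _ i_gt0)) !addn0; do 2 case: odd.
Qed.

(** One flag for each of the [n.+2] runs of a period; the parity makes any one of these flags
    recoverable from the others. *)
Definition parity_bit n t i :=
  if i <= n then odd (t %/ 2 ^ i) else odd (\sum_(j < n.+1) odd (t %/ 2 ^ j)).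

(* The digits below [r] of [t + 1] give those of [t]; then at most one bit of [t]
   is missing. *)
Lemma parity_bit_eqmod n r t t' : r < n.+2 ->
  (forall i, r < i < n.+2 -> parity_bit n t i = parity_bit n t' i) ->
  (forall i, i < r -> parity_bit n t.+1 i = parity_bit n t'.+1 i) ->
  t = t' %[mod 2 ^ n.+1].
Proof.
move=> lt_r hi lo.
have low i : i < r -> odd (t %/ 2 ^ i) = odd (t' %/ 2 ^ i).
  apply/eqmod_exp2: i; apply/eqP; rewrite -(eqn_modDr 1) !addn1; apply/eqP.
  apply/eqmod_exp2 => i lt_ir; have := lo i lt_ir.
  by have le_in : i <= n by [lia]; rewrite /parity_bit le_in.
apply/eqmod_exp2 => i lt_in.
have [/low//|lt_ri|Eir] := ltngtP i r.
  by have := hi i; rewrite /parity_bit lt_ri ltnW // -ltnS lt_in; apply.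
have := hi n.+1; rewrite /parity_bit ltnn -Eir lt_in ltnSn => /(_ isT).
rewrite (bigD1 (Ordinal lt_in)) //= [in RHS](bigD1 (Ordinal lt_in)) //= !oddD.
have -> : \sum_(j < n.+1 | j != Ordinal lt_in) odd (t %/ 2 ^ j) =
          \sum_(j < n.+1 | j != Ordinal lt_in) odd (t' %/ 2 ^ j).
  apply: eq_bigr => j; rewrite -val_eqE /= => neq_ji.
  have [lt_ji|lt_ij|Eji] := ltngtP j i; last by rewrite Eji eqxx in neq_ji.
    by rewrite low // -Eir.
  have le_jn : j <= n by rewrite -ltnS ltn_ord.
  have := hi j; rewrite /parity_bit -Eir lt_ij le_jn => -> //.
  by rewrite ltnS leqW.
by move/addIb; rewrite !oddb.
Qed.

Definition transpose_succ p i := if i == p then p.+1 else if i == p.+1 then p else i.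

(** * Locating a turn in the sequence of periods *)

Section Periods.
Variables (n N : nat) (letter : nat -> nat -> nat).
Local Notation q := n.+2.
Local Notation M := (2 ^ n).
Hypothesis letter_lt : forall m r, m < N -> r < q -> letter m r < q.
Hypothesis letter_inj : forall m r s, m < N -> r < q -> s < q ->
  letter m r = letter m s -> r = s.
Hypothesis letter_surj : forall m v, m < N -> v < q -> exists2 r, r < q & letter m r = v.
Hypothesis letter0 : forall m, m < N -> letter m 0 = 0.
Hypothesis letter_perm_inj : forall m m', m < N -> m' < N ->
  (forall r, r < q -> letter m r = letter m' r) -> m = m'.
Hypothesis letter_swap : forall m, m.+1 < N ->
  exists p, p.+1 < q /\ forall r, r < q -> letter m.+1 r = letter m (transpose_succ p r).

Definition period_letter k := letter (k %/ q %/ M) (k %% q).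
Definition period_doubled k := parity_bit n (k %/ q) (k %% q).

Local Notation L := period_letter.
Local Notation D := period_doubled.

Lemma period_letterE t r : r < q -> L (t * q + r) = letter (t %/ M) r.
Proof. by move=> lt_r; rewrite /L divnMDl // modnMDl (divn_small lt_r) (modn_small lt_r) addn0. Qed.

Lemma period_doubledE t r : r < q -> D (t * q + r) = parity_bit n t r.
Proof. by move=> lt_r; rewrite /D divnMDl // modnMDl (divn_small lt_r) (modn_small lt_r) addn0. Qed.

(** The letter at [r0] is the only one left over by the other places. *)
Lemma letter_perm_inj1 r0 m m' : m < N -> m' < N ->
  (forall r, r < q -> r != r0 -> letter m r = letter m' r) -> m = m'.
Proof.
move=> lt_m lt_m' Em; apply: letter_perm_inj => // r lt_r.
have [Er|/Em->//] := eqVneq r r0.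
have [j lt_j Ej] := letter_surj lt_m' (letter_lt lt_m lt_r).
have [Ejr|neq_jr] := eqVneq j r; first by rewrite -Ej Ejr.
by case/eqP: (neq_jr); apply: (letter_inj lt_m) => //; rewrite Em // -Er.
Qed.

Lemma period_divn_lt t : t < N * M -> t %/ M < N.
Proof. by move=> lt_t; rewrite ltn_divLR // expn_gt0. Qed.

Lemma period_letter_lt k : k < q * (N * M) -> L k < q.
Proof.
by move=> lt_k; apply: letter_lt; [apply: period_divn_lt; rewrite ltn_divLR // mulnC | rewrite ltn_pmod].
Qed.

Lemma period_letter_eq0 k : k < q * (N * M) -> L k = 0 -> q %| k.
Proof.
move=> lt_k; have lt_m : k %/ q %/ M < N by apply: period_divn_lt; rewrite ltn_divLR // mulnC.
by rewrite -(letter0 lt_m) => /letter_inj E; apply/eqP; apply: E => //; rewrite ltn_pmod.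
Qed.

(* [r2] is the place in period [t + 1] of the letter at place [r] in period [t].
   In the first case the letters at the places [>= r] of period [t] followed by
   those at the places [<= r] of period [t + 1] form one of the two permutations. *)
Lemma next_occurrence t r r2 : t.+1 < N * M -> r2 <= r < q ->
  letter (t %/ M) r = letter (t.+1 %/ M) r2 ->
  (r2 = r /\ exists e, [/\ e = t %/ M \/ e = (t %/ M).+1, e < N,
      forall i, i <= r -> letter (t.+1 %/ M) i = letter e i &
      forall i, r <= i < q -> letter (t %/ M) i = letter e i]) \/
  [/\ M %| t.+1, r2.+1 = r & forall i, r < i < q -> letter (t.+1 %/ M) i = letter (t %/ M) i].
Proof.
move=> lt_tT /andP[le_r2 lt_r]; have lt_m := period_divn_lt (ltnW lt_tT).
have := period_divn_lt lt_tT; rewrite divnS ?expn_gt0 //.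
have lt_r2 := leq_ltn_trans le_r2 lt_r.
case Mt: (M %| t.+1) => /=; rewrite ?add0n ?add1n => lt_m1; last first.
  by move/(letter_inj lt_m lt_r lt_r2) <-; left; split=> //; exists (t %/ M); split=> //; left.
have [p [lt_p Ep]] := letter_swap lt_m1.
rewrite Ep // => /letter_inj; rewrite /transpose_succ => /(_ lt_m lt_r) Er.
have {Er} : r = transpose_succ p r2.
  by apply: Er; rewrite /transpose_succ; do 2 case: ifP => // _; lia.
rewrite /transpose_succ; have [Er2 Er|neq_p] := eqVneq r2 p.
  right; split; rewrite // ?Er2 // => i lt_ri; rewrite Ep; last by lia.
  by rewrite /transpose_succ !ifN //; lia.
have [Er2 Er|neq_p1 Er] := eqVneq r2 p.+1; first by lia.
left; split=> //; have [lt_rp|le_pr] := ltnP r p.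
  exists (t %/ M); split=> //; first by left.
  by move=> i le_ir; rewrite Ep /transpose_succ ?ifN //; lia.
exists (t %/ M).+1; split=> //; first by right.
by move=> i /andP[le_ri lt_i]; rewrite Ep /transpose_succ ?ifN //; lia.
Qed.

(** More than [q] pairwise distinct letters are impossible, and two equal letters cannot lie in one
    period. *)
Lemma period_window k l : 2 <= l -> k + l < q * (N * M) -> L k = L (k + l) ->
  (forall m m', m < m' < l -> L (k + m) <> L (k + m')) ->
  l <= q /\ q <= k %% q + l.
Proof.
move=> l2 lt_kl Lkl Linj.
have le_lq : l <= q.
  rewrite leqNgt; apply/negP => lt_ql.
  have lt_L (i : 'I_q.+1) : L (k + i) < q by apply: period_letter_lt; have := ltn_ord i; lia.
  have /injectivePn[a [b neq_ab /(congr1 val)/= eqL]] :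
      ~~ injectiveb (fun i : 'I_q.+1 => Ordinal (lt_L i)).
    by apply/injectiveP => /leq_card; rewrite !card_ord ltnn.
  have := ltn_ord a; have := ltn_ord b => lt_b lt_a.
  have [lt_ab|lt_ba|/val_inj/eqP] := ltngtP a b; last exact/negP.
    by apply: (Linj a b); first lia.
  by apply: (Linj b a); first lia.
split=> //; rewrite leqNgt; apply/negP => lt_rl.
have lt_m : k %/ q %/ M < N by apply: period_divn_lt; rewrite ltn_divLR // mulnC; lia.
move: Lkl; rewrite {2}(divn_eq k q) -addnA period_letterE // => /(letter_inj lt_m) E.
by have := E (ltn_pmod _ (ltn0Sn _)) lt_rl; lia.
Qed.

Lemma period_window_uniq k k' l :
  2 <= l -> k + l < q * (N * M) -> k' + l < q * (N * M) ->
  L k = L (k + l) -> (forall m, m <= l -> L (k + m) = L (k' + m)) ->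
  (forall m, 0 < m < l -> D (k + m) = D (k' + m)) ->
  (forall m m', m < m' < l -> L (k + m) <> L (k + m')) -> k = k'.
Proof.
move=> l2 lt_kl lt_kl' Lkl Lkk' Dkk' Linj.
have [le_lq le_q] := period_window l2 lt_kl Lkl Linj.
have Lkl' : L k' = L (k' + l) by rewrite -Lkk' // -Lkl; have := Lkk' 0 isT; rewrite !addn0.
have lt_r : k %% q < q by rewrite ltn_pmod.
(* The window reaches the start of a period, where the letter is [0]; as [0] occurs only at such
   starts, the residues agree. *)
have Er : k' %% q = k %% q.
  have z_k : L (k + (q - k %% q)) = 0.
    have -> : k + (q - k %% q) = (k %/ q).+1 * q + 0.
      by rewrite {1}(divn_eq k q) mulSn; lia.
    rewrite period_letterE // letter0 //; apply: period_divn_lt.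
    rewrite -(ltn_pmul2r (ltn0Sn n.+1)) mulSn; have := divn_eq k q; lia.
  have lt_r' : k' %% q < q by rewrite ltn_pmod.
  have : q %| k' + (q - k %% q).
    by apply: period_letter_eq0; [lia | rewrite -Lkk' //; lia].
  rewrite {1}(divn_eq k' q) -addnA dvdn_addr ?dvdn_mull // => /dvdnP[c Ec].
  have : c = 1; last by lia.
  by case: c Ec => [|[|c]] //; rewrite ?mulSn; lia.
move: lt_r le_q Er; move: (divn_eq k q) (divn_eq k' q).
move: (k %% q) (k' %% q) (k %/ q) (k' %/ q) => r r' t t' Ek Ek' lt_r le_q Er.
subst r'; pose r2 := r + l - q.
have Ekl : k + l = t.+1 * q + r2 by rewrite Ek mulSn /r2; lia.
have Ekl' : k' + l = t'.+1 * q + r2 by rewrite Ek' mulSn /r2; lia.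
have r2_int : r2 <= r < q by rewrite /r2; lia.
have lt_tT : t.+1 < N * M by rewrite -(ltn_pmul2r (ltn0Sn n.+1)); lia.
have lt_tT' : t'.+1 < N * M by rewrite -(ltn_pmul2r (ltn0Sn n.+1)); lia.
have lt_r2 : r2 < q by lia.
have hi_t i : r <= i < q -> i - r <= l -> letter (t %/ M) i = letter (t' %/ M) i.
  move=> i_int le_l; have := Lkk' _ le_l; rewrite Ek Ek' -!addnA subnKC; last by lia.
  by rewrite !period_letterE //; lia.
have lo_t i : i <= r2 -> letter (t.+1 %/ M) i = letter (t'.+1 %/ M) i.
  move=> le_i; have le_l : q - r + i <= l by rewrite /r2 in le_i; lia.
  have := Lkk' _ le_l.
  have -> : k + (q - r + i) = t.+1 * q + i by rewrite Ek mulSn; lia.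
  have -> : k' + (q - r + i) = t'.+1 * q + i by rewrite Ek' mulSn; lia.
  by rewrite !period_letterE //; lia.
have := next_occurrence lt_tT r2_int; have := next_occurrence lt_tT' r2_int.
move: Lkl Lkl'; rewrite Ekl Ekl' {1}Ek {1}Ek' !period_letterE // => Lkl Lkl' /(_ Lkl') next' /(_ Lkl) next.
suff Et : t = t' by rewrite Ek Ek' Et.
have M_gt0 : 0 < M by rewrite expn_gt0.
(* In the swap case [l = q - 1]: the arrangement of period [t.+1] is known except at place [r], and
   its index gives [t.+1], a multiple of [M]. *)
have [[Er2 [e [Ee lt_e lo_e hi_e]]]|[Mt Er2 hi]] := next; last first.
  have [[]|[Mt' _ hi']] := next'; first by lia.
  suff Et : t.+1 %/ M = t'.+1 %/ M.
    by apply: succn_inj; rewrite -(divnK Mt) -(divnK Mt') Et.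
  apply: (@letter_perm_inj1 r); try exact: period_divn_lt.
  move=> i lt_i neq_ir; have [lt_ri|lt_ir] := ltnP r i; last by apply: lo_t; lia.
  by rewrite hi ?hi' ?lt_ri // hi_t //; lia.
have [[_ [e' [Ee' lt_e' lo_e' hi_e']]]|[]] := next'; last by lia.
have Eee' : e = e'.
  apply: letter_perm_inj => // i lt_i; have [le_ri|lt_ir] := leqP r i.
    by rewrite -hi_e ?le_ri // -hi_e' ?le_ri // hi_t ?le_ri //; rewrite /r2 in Er2; lia.
  by have le_ir := ltnW lt_ir; rewrite -lo_e // -lo_e' // lo_t // Er2.
have El : l = q by rewrite /r2 in Er2; lia.
(* The inner runs show the flags after place [r] in period [t] and before place [r] in period
   [t.+1]. *)
have Etmod : t = t' %[mod 2 ^ n.+1].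
  apply: (parity_bit_eqmod lt_r) => i i_int.
    have := Dkk' (i - r); rewrite Ek Ek' -!addnA subnKC; last by lia.
    by rewrite !period_doubledE ?El; [apply; lia | lia | lia].
  have := Dkk' (q - r + i).
  have -> : k + (q - r + i) = t.+1 * q + i by rewrite Ek mulSn; lia.
  have -> : k' + (q - r + i) = t'.+1 * q + i by rewrite Ek' mulSn; lia.
  by rewrite !period_doubledE ?El; [apply; lia | lia | lia].
(* Digit [n] of [t] is the parity of the index [t %/ M]; it decides whether [e] is this index or the
   next one. *)
have odd_t : odd (t %/ M) = odd (t' %/ M) by move/eqmod_exp2: Etmod; apply.
have mod_t : t %% M = t' %% M.
  by move/eqmod_exp2: Etmod => Etmod; apply/eqmod_exp2 => i lt_i; apply: Etmod; rewrite ltnW.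
rewrite (divn_eq t M) (divn_eq t' M) mod_t; congr (_ * _ + _).
move: Ee Ee' odd_t; rewrite -Eee'; move: (t %/ M) (t' %/ M) => m m'; clear.
by case=> -> [] => [//|Em|Em|[]//]; rewrite ?Em -?Em /= => odd_m; lia.
Qed.

(** Across a period boundary the next letter is [0], which occurs only at starts of periods. *)
Lemma period_letter_neq k : k.+1 < q * (N * M) -> L k <> L k.+1.
Proof.
move=> lt_k Lk; have lt_r : k %% q < q by rewrite ltn_pmod.
have lt_m : k %/ q %/ M < N by apply: period_divn_lt; rewrite ltn_divLR // mulnC; lia.
have [lt_r1|le_r1] := ltnP (k %% q).+1 q.
  move: Lk; rewrite [in RHS](divn_eq k q) -addnS period_letterE //.
  by move/(letter_inj lt_m lt_r lt_r1); lia.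
have Ek : k.+1 = (k %/ q).+1 * q + 0 by rewrite {1}(divn_eq k q) mulSn; lia.
have Lk0 : L k = 0.
  rewrite Lk Ek period_letterE // letter0 //; apply: period_divn_lt.
  by rewrite -(ltn_pmul2r (ltn0Sn n.+1)); lia.
by have /dvdnP[c Ec] := period_letter_eq0 (ltnW lt_k) Lk0; move: le_r1; rewrite Ec modnMl; lia.
Qed.
End Periods.

(** * The arrangements given by the permutation list *)

Definition sjt_letter n m r := nth 0 (0 :: nth [::] (sjt n.+1) m) r.

Section SjtLetter.
Variable n : nat.
Local Notation q := n.+2.
Local Notation N := (n.+1)`!.
Local Notation letter := (sjt_letter n).

Lemma sjt_nth_perm m : m < N -> perm_eq (0 :: nth [::] (sjt n.+1) m) (iota 0 q).
Proof.
by move=> lt_m; rewrite -[iota 0 q]/(0 :: iota 1 n.+1) perm_cons sjt_perm // mem_nth // sjt_size.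
Qed.

Lemma sjt_nth_size m : m < N -> size (0 :: nth [::] (sjt n.+1) m) = q.
Proof. by move/sjt_nth_perm/perm_size; rewrite size_iota. Qed.

Lemma sjt_letter_lt m r : m < N -> r < q -> letter m r < q.
Proof.
move=> lt_m lt_r; have := mem_iota 0 q (letter m r); rewrite add0n /= => <-.
by rewrite -(perm_mem (sjt_nth_perm lt_m)) mem_nth // sjt_nth_size.
Qed.

Lemma sjt_letter_inj m r s : m < N -> r < q -> s < q -> letter m r = letter m s -> r = s.
Proof.
move=> lt_m lt_r lt_s /eqP; rewrite nth_uniq ?sjt_nth_size // => [/eqP//|].
by rewrite (perm_uniq (sjt_nth_perm lt_m)) iota_uniq.
Qed.

Lemma sjt_letter_surj m v : m < N -> v < q -> exists2 r, r < q & letter m r = v.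
Proof.
move=> lt_m lt_v; have : v \in 0 :: nth [::] (sjt n.+1) m.
  by rewrite (perm_mem (sjt_nth_perm lt_m)) mem_iota.
by case/(nthP 0) => r; rewrite sjt_nth_size // => lt_r <-; exists r.
Qed.

Lemma sjt_letter_perm_inj m m' : m < N -> m' < N ->
  (forall r, r < q -> letter m r = letter m' r) -> m = m'.
Proof.
move=> lt_m lt_m' Em.
have [E] : 0 :: nth [::] (sjt n.+1) m = 0 :: nth [::] (sjt n.+1) m'.
  by apply: (@eq_from_nth _ 0); rewrite !sjt_nth_size.
by apply/eqP; rewrite -(nth_uniq [::] _ _ (sjt_uniq n.+1)) ?E ?sjt_size.
Qed.

Lemma sjt_letter_swap m : m.+1 < N ->
  exists p, p.+1 < q /\ forall r, r < q -> letter m.+1 r = letter m (transpose_succ p r).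
Proof.
move=> lt_m; have /(sortedP [::]) := sjt_sorted n.+1.
rewrite sjt_size => /(_ m lt_m) /asboolP[u [v [a [b [Em Em1]]]]].
have := sjt_nth_size (ltnW lt_m); rewrite Em /= size_cat /= => sz_q.
(* The successor accounts for the letter [0] put in front of the permutation. *)
exists (size u).+1; split=> [|r lt_r]; first by rewrite -sz_q !addnS !ltnS leq_addr.
rewrite /sjt_letter Em Em1 /transpose_succ.
case: r lt_r => [//|r] _; rewrite !eqSS /= !nth_cat.
have [->|neq_r] := eqVneq r (size u).
  by rewrite /= nth_cat ltnn subnn ltnNge leqnSn /= subSnn.
have [->|neq_r1] := eqVneq r (size u).+1.
  by rewrite /= nth_cat ltnn subnn ltnNge leqnSn /= subSnn.
rewrite /= nth_cat; case: ltnP => // le_ur.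
move: (subnKC le_ur) neq_r neq_r1; case: (r - size u) => [|[|c]] //= Er.
  by rewrite -Er addn0 eqxx.
by rewrite -Er addn1 eqxx.
Qed.
End SjtLetter.

(** * The lower bound *)

Lemma zimin3_lower n m : m <= n.+2 * (n.+1`! * 2 ^ n) -> ~ zimin_unavoidable 3 n.+2 m.
Proof.
move=> le_m; pose L := period_letter n (sjt_letter n); pose D := period_doubled n.
pose w : seq 'I_n.+2 := mkseq (fun p => inord (block_word L D p)) m.
move=> /(_ w); rewrite size_mkseq => /(_ erefl) /(contains_zimin3_at ord0).
rewrite size_mkseq => -[i [j [d [d2 lt_ij lt_jm Wd Wij]]]].
have wE p p' : p < m -> p' < m -> nth ord0 w p = nth ord0 w p' -> block_word L D p = block_word L D p'.
  move=> lt_p lt_p'; rewrite !nth_mkseq // => /(congr1 val) /=.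
  have lt_L k : k < m -> block_word L D k < n.+2.
    move=> lt_k; apply: (period_letter_lt (@sjt_letter_lt n)).
    by have := block_at_le D k; lia.
  by rewrite !inordK ?lt_L.
(* A position never precedes its block index, so [m] positions stay within the blocks covered by the
   period lemmas. *)
apply: (@block_word_zimin3_free _ L D (n.+2 * (n.+1`! * 2 ^ n))).
- exact: (period_letter_neq (@sjt_letter_inj n)).
- exact: (period_window_uniq (@sjt_letter_lt n) (@sjt_letter_inj n)
    (@sjt_letter_surj n) _ (@sjt_letter_perm_inj n) (@sjt_letter_swap n)).
exists i, j, d; split=> //; first by lia.
  by apply: wE => //; lia.
by move=> e le_e; apply: wE (Wij e le_e); lia.
Qed.


(** * Both bounds with explicit constants *)

(** The term [2 * q] is absorbed by [q <= 2 ^ q * q!], whence 18 = 16 + 2. *)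
Lemma zimin_length3_upper q : 0 < q -> zimin_length 3 q <= 18 * (2 ^ q * q`!).
Proof.
move=> q_gt0; have le_up := (zimin_lengthP 3 q).2 _ (@zimin3_upper q).
have le_q : q <= 2 ^ q * q`!.
  by apply: leq_trans (ltnW (ltn_expl q (leqnn 2))) _; rewrite leq_pmulr // fact_gt0.
by move: (2 ^ q * q`!) (zimin_length 3 q) le_q le_up => a b; clear; lia.
Qed.

(** For [q = n.+2] the 4 is the quotient of [2 ^ q] by [2 ^ n]; for [q = 1] it is enough that the
    empty word avoids [Z_3]. *)
Lemma zimin_length3_lower q : 0 < q -> 2 ^ q * q`! <= 4 * zimin_length 3 q.
Proof.
have := (zimin_lengthP 3 q).1; case: q => [//|[|n]] unav _.
  case: (zimin_length 3 1) unav => [|m _]; last by rewrite mulnS.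
  move=> /(_ [::] erefl) /(contains_zimin3_at ord0).
  by case=> i [j [d []]].
rewrite leqNgt; apply/negP => lt_m; apply: (zimin3_lower _ unav).
suff E : 2 ^ n.+2 * (n.+2)`! = 4 * (n.+2 * ((n.+1)`! * 2 ^ n)) by rewrite E in lt_m; lia.
by rewrite !expnS [(n.+2)`!]factS; move: (n.+1)`! (2 ^ n) => a b; nia.
Qed.

Import Order.TTheory GRing.Theory Num.Theory.
Local Open Scope ring_scope.

Theorem theorem1p3 (R : realType) :
  exists c C : R, [/\ 0 < c, 0 < C &
    forall q : nat, (0 < q)%N ->
      c * (2 ^ q * q`!)%N%:R <= (zimin_length 3 q)%:R <= C * (2 ^ q * q`!)%N%:R].
Proof.
exists (4^-1), 18; split => [| |q q_gt0]; rewrite ?invr_gt0 ?ltr0n //.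
rewrite -natrM ler_nat zimin_length3_upper // andbT.
by rewrite ler_pdivrMl ?ltr0n // -natrM ler_nat zimin_length3_lower.
Qed.
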